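(* Let $m,n,p\in\mathbb{N}$ be such that $m<n$ and let $A$ be a bounded operator on a complex Hilbert space $\mathcal{H}$. Then the following conditions are equivalent: (i) $(A^* )^sA^s=(A^*A)^s$ for all $s\in\{p,\,m,\,m+p,\,n,\,n+p\}$; (ii) $A$ is quasinormal.
   Context: $\mathbb{N}$ denotes the set of positive integers. A bounded operator $A$ on a complex Hilbert space is called quasinormal if $A(A^*A)=(A^*A)A$. *)

(* Defs.v *)
From HB Require Import structures.
From mathcomp Require Import all_boot all_order all_algebra.
From mathcomp Require Import sesquilinear complex.
From mathcomp Require Import all_classical reals topology normedtype.

Set Implicit Arguments.
Unset Strict Implicit.
Unset Printing Implicit Defensive.

Import Order.TTheory GRing.Theory Num.Theory.
Import numFieldNormedType.Exports.

Local Open Scope classical_set_scope.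
Local Open Scope ring_scope.
Local Open Scope complex_scope.

(* A complex Hilbert space: a complete normed space over R[i] whose norm comes
   from an inner product, linear in its first argument and conjugate-linear in
   its second one. *)
HB.mixin Record CompleteNormedModule_isHilbert (R : realType) H
    & CompleteNormedModule R[i] H := {
  hdot : {dot H for Num.conj} ;
  normr_hdot : forall x : H, `|x| ^+ 2 = hdot x x
}.

#[short(type="hilbertType")]
HB.structure Definition Hilbert (R : realType) :=
  { H of CompleteNormedModule R[i] H & CompleteNormedModule_isHilbert R H }.

Definition bounded_operator (R : realType) (H : hilbertType R)
    (A : {linear H -> H}) : Prop :=
  exists M : R, forall x : H, `|A x| <= M%:C * `|x|.

(* The value at y of the adjoint of A is the vector z, unique if it exists, such
   that <A x, y> = <x, z> for all x; it exists when A is bounded, by the Riesz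
   representation theorem. The default value 0 is then irrelevant. *)
Definition adjoint (R : realType) (H : hilbertType R) (A : H -> H) : H -> H :=
  fun y => xget 0 [set z | forall x, hdot (A x) y = hdot x z].

Definition quasinormal (R : realType) (H : hilbertType R) (A : H -> H) : Prop :=
  A \o (adjoint A \o A) = (adjoint A \o A) \o A.

(* Main.v *)
From HB Require Import structures.
Require Import Defs.
From mathcomp Require Import all_boot all_order all_algebra.
From mathcomp Require Import complex.
From mathcomp Require Import all_classical reals topology normedtype.
From mathcomp Require Import sesquilinear derive realfun ring lra.

(* Put T = A* A. The hypotheses say that B = A^p satisfies
   B* T^k B = T^(k+p) for k = 0, m, n. By the weighted AM-GM inequality,
   g_t(s) = m s^n + (n-m) t^n - n t^(n-m) s^m is (s - t)^2 times a polynomial in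
   s and t with nonnegative coefficients, one of which is a positive multiple of
   t^(n-2); as <g_t(T) B x, B x> = <g_t(T) T^p x, x>, this yields
   t^(n-2) |(T - t) B x|^2 <= C |(T - t) x|^2 uniformly in t in [0, |A|^2].
   Such an estimate forces T B = B T: if G = T B - B T, then G T^(n-1) x is
   dominated by |(T - t) x| for every t at once, and a bounded functional with
   that property vanishes. So T commutes with A^p, whence A* T^(jp) A = T^(jp+1)
   for all j, so that |T^p A x - A T^p x|^2 = 0. Finally
   t^(p-1) |(T - t) y| <= |(T^p - t^p) y|, so T^p A = A T^p gives an estimate of
   the same kind with B = A. *)

Section HilbertSpace.
Local Open Scope classical_set_scope.
Local Open Scope ring_scope.
Local Open Scope complex_scope.
Import Order.TTheory GRing.Theory Num.Theory.
Import numFieldNormedType.Exports.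

Set Implicit Arguments.
Unset Strict Implicit.
Unset Printing Implicit Defensive.

Context {R : realType} {H : hilbertType R}.
Implicit Types (x y z u v w : H) (a t : R).

(** * The real part of the inner product *)

Definition rdot x y : R := complex.Re (hdot x y).

Lemma rdotC x y : rdot x y = rdot y x.
Proof.
have := @hermC _ false _ H (@hdot R H) x y.
rewrite /rdot expr0 mul1r => ->.
suff: forall c : R[i], complex.Re c^* = complex.Re c by apply.
by case.
Qed.

Lemma rdotDl x y z : rdot (x + y) z = rdot x z + rdot y z.
Proof. by rewrite /rdot linearDl raddfD. Qed.

Lemma rdotZl a x y : rdot (a%:C *: x) y = a * rdot x y.
Proof.
rewrite /rdot linearZl_LR.
suff: forall c : R[i], complex.Re (a%:C * c) = a * complex.Re c by apply.
by case=> b c /=; rewrite mul0r subr0.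
Qed.

Lemma rdotDr x y z : rdot x (y + z) = rdot x y + rdot x z.
Proof. by rewrite rdotC rdotDl !(rdotC x). Qed.

Lemma rdotZr a x y : rdot x (a%:C *: y) = a * rdot x y.
Proof. by rewrite rdotC rdotZl (rdotC x). Qed.

Lemma rdotNl x y : rdot (- x) y = - rdot x y.
Proof. by rewrite /rdot linearNl raddfN. Qed.

Lemma rdotNr x y : rdot x (- y) = - rdot x y.
Proof. by rewrite rdotC rdotNl (rdotC x). Qed.

Lemma rdotBl x y z : rdot (x - y) z = rdot x z - rdot y z.
Proof. by rewrite rdotDl rdotNl. Qed.

Lemma rdotBr x y z : rdot x (y - z) = rdot x y - rdot x z.
Proof. by rewrite rdotDr rdotNr. Qed.

Definition rdotE :=
  (rdotBl, rdotBr, rdotDl, rdotDr, rdotNl, rdotNr, rdotZl, rdotZr).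

Lemma rdot_norm x : (rdot x x)%:C = `|x| ^+ 2.
Proof.
have e := normr_hdot x; rewrite e RRe_real // -e.
by rewrite ger0_real // exprn_ge0.
Qed.

Lemma rdot_ge0 x : 0 <= rdot x x.
Proof. by rewrite -(@lecR R) rdot_norm exprn_ge0. Qed.

Lemma rdot0l x : rdot 0 x = 0.
Proof. by rewrite /rdot linear0l. Qed.

Lemma rdot_eq0 x : (rdot x x == 0) = (x == 0).
Proof.
apply/idP/idP=> [/eqP e|/eqP ->]; last by rewrite rdot0l.
by have /esym/eqP := rdot_norm x; rewrite e expf_eq0 normr_eq0.
Qed.

(** Taking [z = x - y] shows that real parts already separate vectors, so identities between vectors
    can be tested with [rdot] alone. *)
Lemma rdot_eqP x y : (forall z, rdot z x = rdot z y) -> x = y.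
Proof.
move=> e; apply/eqP; rewrite -subr_eq0 -rdot_eq0.
by rewrite rdotBr e subrr.
Qed.

Lemma sqr_rdot_le x y : rdot x y ^+ 2 <= rdot x x * rdot y y.
Proof.
have [->|y0] := eqVneq y 0.
  by rewrite rdotC !rdot0l expr0n mulr0.
have yy : 0 < rdot y y by rewrite lt_def rdot_ge0 rdot_eq0 y0.
(* The squared norm of |y|^2 x - <x,y> y is |y|^2 (|x|^2 |y|^2 - <x,y>^2), with no division
   involved. *)
have := rdot_ge0 ((rdot y y)%:C *: x - (rdot x y)%:C *: y).
rewrite !rdotE (rdotC y x).
rewrite (_ : _ - _ = rdot y y * (rdot x x * rdot y y - rdot x y ^+ 2)).
  by rewrite pmulr_rge0 // subr_ge0.
by ring.
Qed.

Lemma rdotD_le x y :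
  rdot (x + y) (x + y) <= 2 * (rdot x x + rdot y y).
Proof.
by have := rdot_ge0 (x - y); rewrite !rdotE (rdotC y x); lra.
Qed.

(** * Completeness, and Riesz representation in the closure of a range *)

(** The rate is the one that the parallelogram law gives for a sequence minimizing a quadratic
    functional up to 1/(i+1). *)
Lemma rdot_complete (w : nat -> H) (c : R) :
  (forall i j, rdot (w i - w j) (w i - w j) <= c * (i.+1%:R^-1 + j.+1%:R^-1)) ->
  exists u, forall e : R, 0 < e ->
    exists N, forall i, (N <= i)%N -> rdot (w i - u) (w i - u) < e.
Proof.
move=> wC.
have pw x (e : R) : 0 < e -> (rdot x x < e ^+ 2) = (`|x| < e%:C).
  move=> e0; rewrite -(@ltcR R) rdot_norm rmorphXn /=.
  by rewrite ltr_pXn2r // nnegrE // lecR ltW.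
have cvw : cvg (w @ \oo).
  apply/cauchy_cvgP/cauchy_exP => e e0.
  have eE : e = (complex.Re e)%:C by rewrite RRe_real // ger0_real // ltW.
  set r := complex.Re e in eE.
  have r0 : 0 < r by rewrite -(@ltcR R) -eE.
  pose N := Num.truncn ((2 * `|c|) / r ^+ 2).
  exists (w N); exists N => // i /= Ni.
  rewrite -ball_normE /ball_ /= eE -pw //.
  apply: (le_lt_trans (wC _ _)).
  have r2 : 0 < r ^+ 2 by rewrite exprn_gt0.
  have N1 : (2 * `|c|) / r ^+ 2 < N.+1%:R by rewrite truncnS_gt.
  have iN : (i.+1%:R : R)^-1 <= N.+1%:R^-1.
    by rewrite lef_pV2 ?posrE ?ltr0n // ler_nat.
  apply: (@le_lt_trans _ _ (2 * `|c| / N.+1%:R)).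
    rewrite (le_trans (ler_norm _)) // normrM [2 * _]mulrC -mulrA.
    rewrite ler_wpM2l // ger0_norm ?addr_ge0 ?invr_ge0 //.
    by rewrite mulr_natl mulr2n lerD2l.
  by rewrite ltr_pdivrMr ?ltr0n // -ltr_pdivrMl // mulrC.
exists (lim (w @ \oo)) => e e0.
have e1 : 0 < Num.sqrt e by rewrite sqrtr_gt0.
have /cvgrPdist_lt/(_ (Num.sqrt e)%:C) := cvw.
rewrite ltcR => /(_ e1) [N _ NP]; exists N => i /NP /=.
by rewrite distrC -pw // sqr_sqrtr // ltW.
Qed.

Definition real_linear (f : H -> R) :=
  forall a x y, f (a%:C *: x + y) = a * f x + f y.

Lemma real_linearZ f a x : real_linear f -> f (a%:C *: x) = a * f x.
Proof.
move=> fL; have f0 : f 0 = 0.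
  by have := fL 1 0 0; rewrite scaler0 addr0; lra.
by rewrite -[a%:C *: x]addr0 fL f0 addr0.
Qed.

Lemma real_linearD f x y : real_linear f -> f (x + y) = f x + f y.
Proof. by move=> fL; have := fL 1 x y; rewrite scale1r mul1r. Qed.

Lemma rdot_linear (L : {linear H -> H}) v : real_linear (fun w => rdot (L w) v).
Proof. by move=> a x y; rewrite linearP rdotDl rdotZl. Qed.

(* The infimum of [|L w|^2 - 2 f w] is approached along a sequence for which
   [L w] is Cauchy, even though the sequence itself need not converge. *)
Lemma riesz_range (L : {linear H -> H}) (f : H -> R) (C : R) :
  real_linear f -> 0 <= C -> (forall w, f w ^+ 2 <= C * rdot (L w) (L w)) ->
  exists u, [/\ forall w, f w = rdot (L w) u, rdot u u <= C
    & forall e : R, 0 < e -> exists w, rdot (L w - u) (L w - u) < e].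
Proof.
move=> fL C0 fC; pose J w := rdot (L w) (L w) - 2 * f w.
have JC w : - C <= J w.
  rewrite /J; have := fC w; have := rdot_ge0 (L w).
  set q := rdot _ _ => q0 fq.
  (* This follows from (2 f w)^2 <= 4 C q <= (q + C)^2. *)
  suff : 2 * f w <= q + C by lra.
  case: lerP => // h; exfalso.
  have := sqr_ge0 (q - C); have : 0 < (2 * f w - (q + C)) * (2 * f w + (q + C)).
    by apply: mulr_gt0; lra.
  by nra.
have JS : has_inf [set J w | w in setT].
  by split; [exists (J 0), 0 | exists (- C) => _ [w _ <-]].
pose d := inf [set J w | w in setT].
have Jd v : d <= J v by apply: ge_inf; [case: JS | exists v].
have [w Jw] : {w : nat -> H & forall i, J (w i) < d + i.+1%:R^-1}.
  apply: (@choice _ _ (fun i v => J v < d + i.+1%:R^-1)) => i.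
  have i0 : 0 < (i.+1%:R : R)^-1 by rewrite invr_gt0 ltr0n.
  by have [_ [v _ <-] Jv] := inf_adherent i0 JS; exists v.
have [u uP] : exists u, forall e : R, 0 < e ->
    exists N, forall i, (N <= i)%N -> rdot (L (w i) - u) (L (w i) - u) < e.
  (* By the parallelogram law |L w_i - L w_j|^2 = 2 (J w_i + J w_j) - 4 J((w_i + w_j)/2), and [J] is
     at least [d] at the midpoint. *)
  apply: (rdot_complete (c := 2)) => i j.
  have := Jd ((2^-1)%:C *: (w i + w j)).
  have := Jw i; have := Jw j.
  rewrite /J (linearZ_LR L) (linearD L) (real_linearZ _ _ fL) (real_linearD _ _ fL).
  rewrite !rdotE (rdotC (L (w j)) (L (w i))).
  by move: (i.+1%:R^-1) (j.+1%:R^-1) => ri rj; lra.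
have fu v : f v = rdot (L v) u.
  pose q := rdot (L v) (L v).
  have [q0|q0] := eqVneq q 0.
    have /eqP := q0; rewrite rdot_eq0 => /eqP ->; rewrite rdot0l.
    by apply/eqP; rewrite -sqrf_eq0 eq_le sqr_ge0 (le_trans (fC v)) // -/q q0 mulr0.
  have {}q0 : 0 < q by rewrite lt_def q0 rdot_ge0.
  have bi i : (rdot (L (w i)) (L v) - f v) ^+ 2 <= q * i.+1%:R^-1.
    set b := rdot _ _ - _; set r := i.+1%:R^-1.
    (* Near-minimality at w_i, tested at w_i + s v, gives r + 2 s b + s^2 q >= 0; the choice s =
       -b/q minimizes the left side and yields b^2 <= q r. *)
    have : 0 <= r + 2 * (- b / q) * b + (- b / q) ^+ 2 * q.
      have := Jd ((- b / q)%:C *: v + w i); have := Jw i.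
      rewrite /J (linearP L) fL !rdotE (rdotC (L v) (L (w i))) -/q /b -/r; lra.
    rewrite (_ : _ + _ = (q * r - b ^+ 2) / q); last by field; rewrite gt_eqF.
    by rewrite pmulr_lge0 ?invr_gt0 // subr_ge0.
  apply/eqP; rewrite -subr_eq0 -sqrf_eq0 eq_le sqr_ge0 andbT.
  apply/ler_addgt0Pr => e e0; rewrite add0r.
  (* With this bound on both 1/(i+1) and |L w_i - u|^2, the distances from <L w_i, L v> to f v and
     to <L v, u> have squares below e/4. *)
  have e1 : 0 < e / (4 * q) by rewrite divr_gt0 // mulr_gt0.
  have [N NP] := uP _ e1.
  pose i := maxn N (Num.truncn (e / (4 * q))^-1).
  have i1 : i.+1%:R^-1 < e / (4 * q).
    rewrite invf_plt ?posrE ?ltr0n // (lt_le_trans (truncnS_gt _)) // ler_nat.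
    by rewrite ltnS leq_maxr.
  have := NP i (leq_maxl _ _); have := bi i.
  have := sqr_rdot_le (L (w i) - u) (L v).
  rewrite rdotBl (rdotC u) -/q; set p := rdot (_ - u) _.
  move: i1; rewrite !ltr_pdivlMr ?mulr_gt0 //.
  set b := rdot (L (w i)) _; set c := rdot _ u; set r := _^-1 => ? ? ? ?.
  have : (f v - c) ^+ 2 <= 2 * (b - f v) ^+ 2 + 2 * (b - c) ^+ 2.
    by have := sqr_ge0 (b - f v + (b - c)); nra.
  nra.
(* Completing the square; together with J >= -C this bounds |u|^2. *)
have wu i : J (w i) = rdot (L (w i) - u) (L (w i) - u) - rdot u u.
  by rewrite /J fu !rdotE (rdotC u); ring.
exists u; split=> //.
  apply/ler_addgt0Pr => e /uP[N /(_ _ (leqnn N))]; have := JC (w N).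
  by rewrite wu; lra.
by move=> e /uP[N /(_ _ (leqnn N))]; exists (w N).
Qed.

(** * Mean value theorem and vanishing of divisible functionals *)

(** Since [k] is the difference quotient of [F], its continuity at the diagonal makes [k t t] the
    derivative, and the mean value theorem applies. *)
Lemma slope_mean_value (F : R -> R) (k : R -> R -> R) (a b : R) : a < b ->
  (forall s t, a <= s <= b -> a <= t <= b -> F s - F t = (s - t) * k s t) ->
  (forall t e, a <= t <= b -> 0 < e -> exists2 d, 0 < d &
     forall s, a <= s <= b -> `|s - t| < d -> `|k s t - k t t| < e) ->
  exists2 c, a <= c <= b & F b - F a = (b - a) * k c c.
Proof.
move=> ab Fk kC.
have [||c cab ->] := @MVT_segment R F (fun t => k t t) a b (ltW ab).
- move=> t tab; have tab' : a <= t <= b.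
    by move: tab; rewrite in_itv /= => /andP[/ltW -> /ltW].
  suff FD : h^-1 *: (F (h *: 1 + t) - F t) @[h --> 0^'] --> k t t.
    by split; [apply/cvg_ex; exists (k t t) | exact: cvg_lim].
  apply/cvgrPdist_lt => e e0.
  have [d d0 kd] := kC _ _ tab' e0.
  have tn : \forall s \near t, s \in `]a, b[ by exact: near_in_itvoo.
  have /nbhs_ballP[r /= r0 rP] := tn.
  apply/nbhs_ballP; exists (Num.min d r) => /=.
    by rewrite lt_min d0 r0.
  move=> h; rewrite /ball /= sub0r normrN lt_min => /andP[hd hr] h0.
  have hab : a <= h + t <= b.
    have /rP : ball t r (h + t) by rewrite /ball /= opprD addrCA subrr addr0 normrN.
    by rewrite /= in_itv /= => /andP[/ltW -> /ltW].
  have := kd _ hab; rewrite addrK => /(_ hd).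
  rewrite distrC [h *: 1]mulr1 Fk // addrK /GRing.scale /= mulrA mulVf ?mul1r //.
- apply/subspace_continuousP => t; rewrite /= in_itv /= => tab.
  apply/cvgrPdist_lt => e e0.
  (* Near [t] the slope is below |k t t| + 1, which gives a Lipschitz bound at [t]. *)
  have [d d0 kd] := kC t 1 tab ltac:(by []).
  have c0 : 0 < `|k t t| + 1 by rewrite ltr_wpDl.
  apply/nbhs_ballP; exists (Num.min d (e / (`|k t t| + 1))) => /=.
    by rewrite lt_min d0 divr_gt0.
  move=> s; rewrite /ball /= lt_min distrC => /andP[sd se].
  rewrite in_itv /= => sab; rewrite distrC Fk // normrM.
  rewrite ltr_pdivlMr // in se; apply: le_lt_trans se.
  rewrite ler_wpM2l //; have := kd _ sab sd.
  by have := ler_normD (k s t - k t t) (k t t); rewrite subrK; lra.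
by exists c => //; rewrite mulrC.
Qed.

(* [f w = <(T - t) w, u_t>] for a bounded family [u_t], and the function
   [F t = f u_t] satisfies [F s - F t = (s - t) <u_s, u_t>]. So [F' = |u_t|^2],
   whereas [F 0 >= 0 >= F M]: some [u_c] vanishes. *)
Lemma divisible_functional_eq0 (T : {linear H -> H}) (M C : R) (f : H -> R) :
  (forall x y, rdot (T x) y = rdot x (T y)) ->
  (forall x, 0 <= rdot (T x) x <= M * rdot x x) -> 0 < M -> 0 <= C ->
  real_linear f ->
  (forall t w, 0 <= t <= M ->
     f w ^+ 2 <= C * rdot (T w - t%:C *: w) (T w - t%:C *: w)) ->
  forall w, f w = 0.
Proof.
move=> Tsym T0M M0 C0 fL fC.
have /choice[u uP] : forall t, exists u, 0 <= t <= M ->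
    [/\ forall w, f w = rdot (T w - t%:C *: w) u, rdot u u <= C
      & forall e : R, 0 < e -> exists w,
          rdot (T w - t%:C *: w - u) (T w - t%:C *: w - u) < e].
  move=> t; have [t0M|] := boolP (0 <= t <= M); last by exists 0.
  have [u uP] := riesz_range (L := T \- t%:C \*: idfun) fL C0 (fun w => fC t w t0M).
  by exists u.
have fu t w : 0 <= t <= M -> f w = rdot (T w - t%:C *: w) (u t).
  by move=> /uP[+ _ _]; apply.
have uC t : 0 <= t <= M -> rdot (u t) (u t) <= C by move=> /uP[].
have M0M : 0 <= M <= M by lra.
have O0M : 0 <= (0 : R) <= M by lra.
have [|||c c0M Fc] := @slope_mean_value (fun t => f (u t))
  (fun s t => rdot (u s) (u t)) 0 M => //.
- move=> s t s0M t0M; rewrite (fu t (u s) t0M) (fu s (u t) s0M) !rdotE Tsym.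
  by rewrite (rdotC _ (u s)) (rdotC (u t) (u s)); ring.
(* As u_t lies in the closure of the range of T - t, it equals (T - t) w + z with z small. Since
   |u_s - u_t|^2 <= 4 C, the constant 16 (C + 1) makes |<u_s - u_t, z>| <= e/2. *)
- move=> t e t0M e0; have [_ _ /(_ (e ^+ 2 / (16 * (C + 1))))] := uP t t0M.
  have C1 : 0 < 16 * (C + 1) by lra.
  rewrite divr_gt0 ?exprn_gt0 // => /(_ erefl) [w].
  rewrite ltr_pdivlMr // -opprB; set z := u t - _; rewrite rdotNl rdotNr opprK => wz.
  have d0 : 0 < 2 * (1 + C * rdot w w).
    by have := mulr_ge0 C0 (rdot_ge0 w); lra.
  exists (e / (2 * (1 + C * rdot w w))); first exact: divr_gt0.
  move=> s s0M; rewrite ltr_pdivlMr // => sd.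
  (* Both <(T - s) w, u_s> and <(T - t) w, u_t> equal f w, hence <u_s - u_t, (T - t) w> = (s - t)
     <u_s, w>. *)
  have -> : rdot (u s) (u t) - rdot (u t) (u t) =
      rdot (u s - u t) z + (s - t) * rdot (u s) w.
    have := fu s w s0M; rewrite (fu t w t0M) /z !rdotE => h.
    rewrite (rdotC (u s) w) (rdotC (u s) (T w)) (rdotC (u t) (T w)) (rdotC (u t) w).
    by lra.
  apply: (le_lt_trans (ler_normD _ _)); rewrite normrM.
  have h1 : `|rdot (u s - u t) z| <= e / 2.
    rewrite -(@ler_pXn2r _ 2) ?nnegrE //; last lra.
    rewrite real_normK ?num_real // (le_trans (sqr_rdot_le _ _)) //.
    have := rdotD_le (u s) (- u t); rewrite rdotNl rdotNr opprK.
    have := uC s s0M; have := uC t t0M; have := rdot_ge0 z; have := rdot_ge0 (u s - u t).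
    nra.
  have h2 : `|rdot (u s) w| <= 1 + C * rdot w w.
    have := sqr_rdot_le (u s) w; have := uC s s0M; have := rdot_ge0 w.
    rewrite -[_ ^+ 2]real_normK ?num_real //; set b := `|_| => ? ? ?.
    have : b ^+ 2 <= C * rdot w w by nra.
    have := sqr_ge0 (b - 1); nra.
  have := normr_ge0 (s - t); nra.
have F0 : 0 <= f (u 0).
  by rewrite (fu 0) // scale0r subr0; have /andP[] := T0M (u 0).
have FM : f (u M) <= 0.
  by rewrite (fu M) // rdotBl rdotZl subr_le0; have /andP[] := T0M (u M).
have uc : u c = 0.
  apply/eqP; rewrite -rdot_eq0 eq_le rdot_ge0 andbT.
  by rewrite -(pmulr_rle0 _ M0) -[M]subr0 -Fc; lra.
by move=> w; rewrite (fu c) // uc rdotC rdot0l.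
Qed.

(** * The weighted AM-GM inequality for moments *)

Definition second_diff t (q : nat -> R) l := q l.+2 - 2 * t * q l.+1 + t ^+ 2 * q l.

(* AM-GM gap [m s^n + (n - m) t^n - n t^(n-m) s^m] at [n = m + k], with a
   moment [q i] in place of [s^i]; it is a nonnegative combination of the second
   differences [second_diff t q l], which correspond to [s^l (s - t)^2]. *)
Definition amgm_gap t (q : nat -> R) m k :=
  k%:R * t ^+ (m + k) * q 0%N + m%:R * q (m + k)%N - (m + k)%:R * t ^+ k * q m.

(** For q i = s^i this is m s^(m+k) (s - t) - t^(k+1) (s^m - t^m). *)
Definition amgm_step t (q : nat -> R) m k :=
  m%:R * q (m + k).+1 - m%:R * t * q (m + k)%N - t ^+ k.+1 * q m
  + t ^+ (m + k).+1 * q 0%N.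

(** This recursion in [k], then those of [amgm_step] in [k] and, at k = 0, in [m], reduce the gap to
    second differences with nonnegative coefficients. *)
Lemma amgm_gapS t q m k : amgm_gap t q m k.+1 =
  t * amgm_gap t q m k + amgm_step t q m k.
Proof.
rewrite /amgm_gap /amgm_step addnS !exprS -[in (m + k).+1%:R]addn1 -[k.+1]addn1.
rewrite !natrD; ring.
Qed.

Lemma amgm_stepS t q m k : amgm_step t q m k.+1 =
  t * amgm_step t q m k + m%:R * second_diff t q (m + k).
Proof. by rewrite /amgm_step /second_diff addnS !exprS; ring. Qed.

Lemma amgm_stepS0 t q m : amgm_step t q m.+1 0 =
  t * amgm_step t q m 0 + m.+1%:R * second_diff t q m.
Proof. by rewrite /amgm_step /second_diff !addn0 !exprS -[m.+1]addn1 natrD; ring. Qed.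

Lemma amgm_step00 t q : amgm_step t q 0 0 = 0.
Proof. by rewrite /amgm_step !mul0r addn0; ring. Qed.

Lemma amgm_gap0 t q m : amgm_gap t q m 0 = 0.
Proof. by rewrite /amgm_gap addn0; ring. Qed.

(** Only the second difference with l = 0 is kept: it enters as [amgm_step t q 1 0], and each later
    step of the recursion multiplies it by [t] and adds a nonnegative term. *)
Lemma amgm_gap_ge t q m k : 0 <= t -> (forall l, 0 <= second_diff t q l) ->
  t ^+ (m + k) * second_diff t q 0 <= amgm_gap t q m.+1 k.+1.
Proof.
move=> t0 q0; have st j : t ^+ (m + j) * second_diff t q 0 <= amgm_step t q m.+1 j.
  elim: j => [|j IH]; last first.
    rewrite amgm_stepS addnS exprS -mulrA.
    by rewrite -[X in X <= _]addr0 lerD ?mulr_ge0 // ler_wpM2l.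
  rewrite addn0; elim: m => [|i IH]; rewrite amgm_stepS0.
    by rewrite amgm_step00 mulr0 add0r expr0.
  by rewrite exprS -mulrA -[X in X <= _]addr0 lerD ?mulr_ge0 // ler_wpM2l.
have gap_ge0 j : 0 <= amgm_gap t q m.+1 j.
  elim: j => [|j IH]; first by rewrite amgm_gap0.
  rewrite amgm_gapS addr_ge0 ?mulr_ge0 // (le_trans _ (st j)) //.
  by rewrite mulr_ge0 ?exprn_ge0.
by rewrite amgm_gapS -[X in X <= _]add0r lerD ?mulr_ge0.
Qed.

(** In the same recursions each factor [t] costs at most [M], so [C] does not depend on [t]. The
    number [N] will be |(T - t) y|^2. *)
Lemma amgm_gap_le (M : R) m k (K : nat -> R) : (forall l, 0 <= K l) -> 0 < M ->
  exists2 C, 0 <= C & forall t N q, 0 <= t <= M -> 0 <= N ->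
    (forall l, second_diff t q l <= K l * N) -> amgm_gap t q m k <= C * N.
Proof.
move=> K0 M0.
have tE t N C (x : R) : 0 <= t <= M -> 0 <= N -> 0 <= C ->
    x <= C * N -> t * x <= (M * C) * N.
  move=> /andP[t0 tM] N0 C0 xC; rewrite -mulrA (le_trans (ler_wpM2l t0 xC)) //.
  by rewrite ler_wpM2r // mulr_ge0.
have stepC j : exists2 C, 0 <= C & forall t N q, 0 <= t <= M -> 0 <= N ->
    (forall l, second_diff t q l <= K l * N) -> amgm_step t q m j <= C * N.
  elim: j => [|j [C C0 IH]]; last first.
    exists (M * C + m%:R * K (m + j)%N) => [|t N q t0M N0 qK].
      by rewrite addr_ge0 ?mulr_ge0 // ltW.
    by rewrite amgm_stepS mulrDl lerD // ?tE ?IH // -mulrA ler_wpM2l.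
  elim: m => [|i [C C0 IH]].
    by exists 0 => // t N q _ _ _; rewrite amgm_step00 mul0r.
  exists (M * C + i.+1%:R * K i) => [|t N q t0M N0 qK].
    by rewrite addr_ge0 ?mulr_ge0 // ltW.
  by rewrite amgm_stepS0 mulrDl lerD // ?tE ?IH // -mulrA ler_wpM2l.
elim: k => [|k [C C0 IH]].
  by exists 0 => // t N q _ _ _; rewrite amgm_gap0 mul0r.
have [C' C'0 SC] := stepC k.
exists (M * C + C') => [|t N q t0M N0 qK].
  by rewrite addr_ge0 ?mulr_ge0 // ltW.
by rewrite amgm_gapS mulrDl lerD // ?tE ?IH // SC.
Qed.

(** * Powers of a bounded positive operator *)

Lemma iter_is_linear k (T : {linear H -> H}) : linear (iter k T).
Proof. by elim: k => // k IH a x y; rewrite iterS IH linearP. Qed.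

HB.instance Definition _ k (T : {linear H -> H}) :=
  GRing.isLinear.Build R[i] H H *:%R (iter k T) (iter_is_linear k T).

Lemma iter_bounded (B : {linear H -> H}) (K : R) k : 0 <= K ->
  (forall x, rdot (B x) (B x) <= K * rdot x x) ->
  forall x, rdot (iter k B x) (iter k B x) <= K ^+ k * rdot x x.
Proof.
move=> K0 BK x; elim: k => [|k IH]; first by rewrite expr0 mul1r.
by rewrite iterS exprS -mulrA (le_trans (BK _)) // ler_wpM2l.
Qed.

Section PositiveOperator.
Context (T : {linear H -> H}) (M : R).
Context (Tsym : forall x y, rdot (T x) y = rdot x (T y)).
Context (T0M : forall x, 0 <= rdot (T x) x <= M * rdot x x).
Context (TM : forall x, rdot (T x) (T x) <= M ^+ 2 * rdot x x).
Context (M0 : 0 < M).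

Local Notation nrm2 x := (rdot x x).
Local Notation Tsub t x := (T x - t%:C *: x).

Lemma iter_sym k x y : rdot (iter k T x) y = rdot x (iter k T y).
Proof. by elim: k x => // k IH x; rewrite iterSr IH Tsym -iterS. Qed.

(** By symmetry |T^(k+1) x|^2 = <T^(k+2) x, T^k x>, so the exponent can be lowered one at a time. *)
Lemma iter_eq0 k x : iter k T x = 0 -> (0 < k)%N -> T x = 0.
Proof.
elim: k => // -[|k] IH // Tk _; apply: IH => //; apply/eqP.
by rewrite -rdot_eq0 [in X in rdot _ X]iterS -Tsym -iterS Tk rdot0l.
Qed.

(** T^(k+1) - t^(k+1) = T^k (T - t) + t (T^k - t^k), with all factors bounded uniformly in [t]. *)
Lemma iter_sub_scale_bounded k : exists2 K, 0 <= K & forall t x, 0 <= t <= M ->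
  nrm2 (iter k T x - (t ^+ k)%:C *: x) <= K * nrm2 (Tsub t x).
Proof.
elim: k => [|k [K K0 IH]].
  exists 0 => // t x _; rewrite mul0r expr0 /= scale1r subrr.
  by rewrite rdot0l.
exists (2 * ((M ^+ 2) ^+ k + M ^+ 2 * K)) => [|t x /[dup] t0M /andP[t0 tM]].
  by have := exprn_ge0 k (exprn_ge0 2 (ltW M0)); nra.
have -> : iter k.+1 T x - (t ^+ k.+1)%:C *: x =
    iter k T (Tsub t x) + t%:C *: (iter k T x - (t ^+ k)%:C *: x).
  have := linearB (iter k T) (T x) (t%:C *: x); have := linearZ_LR (iter k T) t%:C x.
  move=> /= e1 e2; rewrite -iterS iterSr e2 e1 scalerBr scalerA.
  by rewrite -rmorphM -exprS addrA subrK.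
rewrite (le_trans (rdotD_le _ _)) // -[2 * _ * _]mulrA ler_wpM2l //.
rewrite mulrDl lerD //; first exact: iter_bounded (exprn_ge0 2 (ltW M0)) TM _.
rewrite rdotZl rdotZr [t * _]mulrA -expr2 -[M ^+ 2 * K * _]mulrA.
by rewrite ler_pM ?exprn_ge0 ?rdot_ge0 ?IH // lerXn2r ?nnegrE // ltW.
Qed.

(** The weight t^j lets the estimate degenerate near t = 0; composing G = T B - B T with T^(j+1)
    makes up for it, and the condition on kernels then recovers G = 0. *)
Lemma commute_of_divisible (B : {linear H -> H}) (K C : R) j :
  0 <= K -> 0 <= C ->
  (forall x, rdot (B x) (B x) <= K * rdot x x) ->
  (forall x, T x = 0 -> B x = 0) ->
  (forall t x, 0 <= t <= M -> t ^+ j * nrm2 (Tsub t (B x)) <=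
     C * nrm2 (Tsub t x)) ->
  forall x, T (B x) = B (T x).
Proof.
move=> K0 C0 BK kerB tB.
pose G : {linear H -> H} := (T \o B) \- (B \o T).
have GE t x : G x = Tsub t (B x) - B (Tsub t x).
  by rewrite /G (linearB B) (linearZ_LR B) opprB addrA addrNK.
have GK : exists2 KG, 0 <= KG & forall x, nrm2 (G x) <= KG * nrm2 x.
  exists (4 * (M ^+ 2 * K)) => [|x]; first by have := exprn_ge0 2 (ltW M0); nra.
  rewrite /G (le_trans (rdotD_le _ _)) // rdotNl rdotNr opprK.
  have := TM (B x); have := BK (T x); have := BK x; have := TM x.
  have := exprn_ge0 2 (ltW M0); have := rdot_ge0 x.
  set a := rdot x x; set b := rdot (T x) _; set c := rdot (B x) _.
  set d := rdot (B _) _; set e := rdot (T (B x)) _; set m := M ^+ 2.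
  move=> a0 m0 h1 h2 h3 h4.
  have : m * c <= m * (K * a) by rewrite ler_wpM2l.
  have : K * b <= K * (m * a) by rewrite ler_wpM2l.
  lra.
have [KG KG0 {}GK] := GK.
have [Kj Kj0 Tj] := iter_sub_scale_bounded j.+1.
have G0 : forall v w, rdot (G (iter j.+1 T w)) v = 0.
  move=> v.
  apply: (divisible_functional_eq0 (T := T) (M := M)
    (C := 2 * (KG * Kj + M ^+ j.+2 * (2 * (C + M ^+ j * K))) * nrm2 v)) => //.
  - have v0 : 0 <= nrm2 v := rdot_ge0 v.
    move: (M ^+ j) (M ^+ j.+2) (exprn_ge0 j (ltW M0)) (exprn_ge0 j.+2 (ltW M0)).
    by move=> a b a0 b0; rewrite !(mulr_ge0, addr_ge0).
  - exact: (rdot_linear (G \o iter j.+1 T : {linear H -> H})).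
  - move=> t w /[dup] t0M /andP[t0 tM].
    (* The first summand is controlled by (T - t) w. For the second, t^(2j+2) |G w|^2 = t^(j+2) t^j
       |G w|^2, and G = (T - t) B - B (T - t) lets the weighted estimate apply. *)
    have -> : G (iter j.+1 T w) =
        G (iter j.+1 T w - (t ^+ j.+1)%:C *: w) + (t ^+ j.+1)%:C *: G w.
      by rewrite (linearB G) (linearZ_LR G) subrK.
    set p := iter j.+1 T w - _.
    apply: (le_trans (sqr_rdot_le _ _)); rewrite [X in _ <= X]mulrAC.
    apply: ler_wpM2r; first exact: rdot_ge0.
    rewrite (le_trans (rdotD_le _ _)) // -mulrA ler_wpM2l // mulrDl lerD //.
      by rewrite (le_trans (GK _)) // -mulrA ler_wpM2l // Tj.
    rewrite rdotZl rdotZr mulrA (GE t).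
    have h1 : nrm2 (Tsub t (B w) - B (Tsub t w)) <=
        2 * (nrm2 (Tsub t (B w)) + K * nrm2 (Tsub t w)).
      have := rdotD_le (Tsub t (B w)) (- B (Tsub t w)); rewrite rdotNl rdotNr opprK.
      by have := BK (Tsub t w); lra.
    have h2 := tB t w t0M.
    have h3 : t ^+ j <= M ^+ j by apply: lerXn2r; rewrite ?nnegrE // ltW.
    have h4 : t ^+ j.+2 <= M ^+ j.+2 by apply: lerXn2r; rewrite ?nnegrE // ltW.
    have h5 : 0 <= t ^+ j by rewrite exprn_ge0.
    have h6 : 0 <= K * nrm2 (Tsub t w) by rewrite mulr_ge0 ?rdot_ge0.
    rewrite -exprD addSn -addnS addnC exprD -mulrA -[X in _ <= X]mulrA.
    rewrite ler_pM ?exprn_ge0 ?mulr_ge0 ?rdot_ge0 ?exprn_ge0 //.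
    have := ler_wpM2l h5 h1; have := ler_wpM2r h6 h3.
    by lra.
move=> x; apply/eqP; rewrite -subr_eq0; apply/eqP/rdot_eqP => v.
rewrite [RHS]rdotC rdot0l rdotC.
(* Here u is the adjoint of G at v. From G T^(j+1) = 0 follow T^(j+1) u = 0, T u = 0, B u = 0 and G
   u = 0, so |u|^2 = <G u, v> = 0. *)
have [||w|u [uG _ _]] := riesz_range (L := idfun)
  (f := fun w => rdot (G w) v) (C := KG * nrm2 v).
- exact: rdot_linear.
- by rewrite mulr_ge0 ?rdot_ge0.
- by rewrite (le_trans (sqr_rdot_le _ _)) // mulrAC ler_wpM2r ?rdot_ge0 // GK.
have {}uG w : rdot (G w) v = rdot w u by exact: uG.
have Tu : T u = 0.
  apply: (@iter_eq0 j.+1) => //; apply: rdot_eqP => w.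
  by rewrite -iter_sym -(uG (iter _ T w)) G0 rdotC rdot0l.
have u0 : u = 0.
  apply/eqP; rewrite -rdot_eq0 -(uG u) /= (kerB _ Tu) Tu (linear0 T) (linear0 B).
  by rewrite subrr rdot0l.
by rewrite (uG x) u0 rdotC rdot0l.
Qed.

Lemma iter_psd k z : 0 <= rdot (iter k T z) z.
Proof.
elim/ltn_ind: k z => -[|[|k]] IH z; first exact: rdot_ge0.
  by have /andP[] := T0M z.
by rewrite iterS iterSr Tsym IH // ltnW.
Qed.

(** T^(p+1) - t^(p+1) = T (T^p - t^p) + t^p (T - t), and positivity of T makes the cross term in the
    squared norm nonnegative. *)
Lemma sub_scale_power_bound t p y : 0 <= t ->
  t ^+ (2 * p) * nrm2 (Tsub t y) <=
  nrm2 (iter p.+1 T y - (t ^+ p.+1)%:C *: y).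
Proof.
move=> t0; pose W k := iter k T y - (t ^+ k)%:C *: y; set z := Tsub t y.
have WS k : W k.+1 = T (W k) + (t ^+ k)%:C *: z.
  rewrite /W /z (linearB T) (linearZ_LR T) scalerBr scalerA -rmorphM -exprSr.
  by rewrite addrA subrK.
(* The extra power T^j closes the induction: <T^j W_(k+1), z> = <T^(j+1) W_k, z> + t^k <T^j z,
   z>. *)
have W0 k j : 0 <= rdot (iter j T (W k)) z.
  elim: k j => [|k IH] j.
    by rewrite /W expr0 scale1r subrr iter_sym // rdot0l.
  rewrite iter_sym // WS rdotDl rdotZl Tsym -iterS -!iter_sym //.
  by rewrite addr_ge0 ?mulr_ge0 ?exprn_ge0 ?iter_psd.
rewrite -/(W p.+1); clearbody W z.
rewrite WS rdotDl !rdotDr !rdotZl !rdotZr mul2n -addnn exprD.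
have /= := W0 p 1; rewrite (rdotC z).
have := rdot_ge0 (T (W p)); have := exprn_ge0 p t0; nra.
Qed.

(** Symmetry moves one factor of (T - t)^2 to the other side; signs and bounds of second differences
    thus become those of T^l. *)
Lemma second_diff_moment t y l :
  second_diff t (fun i => rdot (iter i T y) y) l =
  rdot (iter l T (Tsub t y)) (Tsub t y).
Proof.
have := linearB (iter l T) (T y) (t%:C *: y); have := linearZ_LR (iter l T) t%:C y.
move=> /= e1 e2; rewrite e2 e1 -iterSr !rdotBl !rdotBr !rdotZl !rdotZr.
by rewrite /second_diff -!Tsym !iterS; ring.
Qed.

Lemma moment_le k z : rdot (iter k T z) z <= ((M ^+ 2) ^+ k + 1) * nrm2 z.
Proof.
have := iter_bounded k (exprn_ge0 2 (ltW M0)) TM z.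
have := rdot_ge0 (iter k T z - z); rewrite !rdotE (rdotC z).
by have := rdot_ge0 (iter k T z); have := rdot_ge0 z; lra.
Qed.

End PositiveOperator.

(** * Existence of the adjoint *)

Lemma bounded_adjointP (A : {linear H -> H}) : bounded_operator A ->
  forall x y, hdot (A x) y = hdot x (adjoint A y).
Proof.
move=> [K AK] x y.
have AK2 w : rdot (A w) (A w) <= K ^+ 2 * rdot w w.
  rewrite -(@lecR R) rmorphM rmorphXn /= !rdot_norm -exprMn.
  by apply: lerXn2r; rewrite ?nnegrE ?(le_trans _ (AK w)).
have [||w|u [uA _ _]] := riesz_range (L := idfun)
  (f := fun w => rdot (A w) y) (C := K ^+ 2 * rdot y y).
- exact: rdot_linear.
- by rewrite mulr_ge0 ?rdot_ge0 // sqr_ge0.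
- by rewrite (le_trans (sqr_rdot_le _ _)) // mulrAC ler_wpM2r ?rdot_ge0.
have uP : [set z | forall x, hdot (A x) y = hdot x z] u.
  move=> z; apply/eqP; rewrite eq_complex; apply/andP; split.
    by apply/eqP; exact: uA.
  (* The real identity at i z is the identity of imaginary parts at z. *)
  have := uA ('i *: z); rewrite /rdot (linearZ_LR A) !linearZl_LR.
  suff iRe (c : R[i]) : complex.Re ('i * c) = - complex.Im c.
    by rewrite /= !iRe => /oppr_inj ->.
  by case: c => a b /=; rewrite mul0r mul1r sub0r.
exact: (xgetPex 0 (ex_intro _ u uP)).
Qed.

(** * The operator T = A* A *)

Section GramOperator.
Context (A : {linear H -> H}) (hA : bounded_operator A).

Let As := adjoint A.

Lemma adjoint_is_linear : linear As.
Proof.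
move=> a x y; apply: rdot_eqP => z; rewrite /rdot -bounded_adjointP //.
rewrite !linearPr; congr (complex.Re (_ + _)); last exact: bounded_adjointP.
by congr (_ * _); exact: bounded_adjointP.
Qed.

Lemma rdot_adjoint x y : rdot (A x) y = rdot x (As y).
Proof. by rewrite /rdot bounded_adjointP. Qed.

HB.instance Definition _ := GRing.isLinear.Build R[i] H H *:%R As adjoint_is_linear.

Let T : {linear H -> H} := As \o A.

(** T commutes with A, so wrapping A* and A around T^s gives A* A T^s = T^(s+1). *)
Lemma quasinormal_iter s : quasinormal A -> iter s As \o iter s A = iter s T.
Proof.
move=> qA; have AT k x : iter k T (A x) = A (iter k T x).
  elim: k => // k IH; rewrite iterS IH.
  exact: esym (congr1 (fun f => f (iter k T x)) qA).
elim: s => // s IH; apply: funext => x.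
have /= := congr1 (fun f => As (f (A x))) IH.
by rewrite -iterSr AT -iterS /T => ->.
Qed.

Context (m n p : nat) (m0 : (0 < m)%N) (p0 : (0 < p)%N) (mn : (m < n)%N).
Context (As_A : forall s, s \in [:: p; m; m + p; n; n + p]%N ->
  iter s As \o iter s A = iter s (As \o A)).

Local Notation nrm2 x := (rdot x x).
Local Notation Tsub t x := (T x - t%:C *: x).

Lemma operator_bound : exists2 M : R, 0 < M &
  (forall x, nrm2 (A x) <= M * nrm2 x) /\ (forall x, nrm2 (As x) <= M * nrm2 x).
Proof.
have [K AK] := hA; exists (K ^+ 2 + 1); first by rewrite ltr_wpDl ?sqr_ge0.
have AM w : nrm2 (A w) <= (K ^+ 2 + 1) * nrm2 w.
  apply: (@le_trans _ _ (K ^+ 2 * nrm2 w)).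
    rewrite -(@lecR R) rmorphM rmorphXn /= !rdot_norm -exprMn.
    by apply: lerXn2r; rewrite ?nnegrE ?(le_trans _ (AK w)).
  by rewrite ler_wpM2r ?rdot_ge0 // lerDl.
split=> // x; have [->|x0] := eqVneq (As x) 0.
  by rewrite rdot0l mulr_ge0 ?rdot_ge0 // addr_ge0 ?sqr_ge0.
have Asx : 0 < nrm2 (As x) by rewrite lt_def rdot_ge0 rdot_eq0 x0.
(* The inner product is |A* x|^2, so |A* x|^4 <= M |A* x|^2 |x|^2, and one factor cancels. *)
have := sqr_rdot_le (A (As x)) x; rewrite rdot_adjoint.
have := AM (As x); have := rdot_ge0 x; nra.
Qed.

Lemma iter_adjoint k x y : rdot (iter k A x) y = rdot x (iter k As y).
Proof. by elim: k x => // k IH x; rewrite iterSr IH rdot_adjoint -iterS. Qed.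

Context (M : R) (M0 : 0 < M).
Context (AM : forall x, nrm2 (A x) <= M * nrm2 x).
Context (AsM : forall x, nrm2 (As x) <= M * nrm2 x).

Lemma gram_sym x y : rdot (T x) y = rdot x (T y).
Proof. by rewrite rdotC -rdot_adjoint rdotC rdot_adjoint. Qed.

Lemma gram_psd x : 0 <= rdot (T x) x <= M * nrm2 x.
Proof. by rewrite rdotC -rdot_adjoint rdot_ge0 AM. Qed.

Lemma gram_bounded x : nrm2 (T x) <= M ^+ 2 * nrm2 x.
Proof. by rewrite (le_trans (AsM _)) // expr2 -mulrA ler_wpM2l // ltW. Qed.

Lemma gram_eq0 x : T x = 0 -> A x = 0.
Proof.
by move=> Tx; apply/eqP; rewrite -rdot_eq0 rdot_adjoint rdotC [As _]Tx rdot0l.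
Qed.

(** * From the five power identities to T A = A T *)

Lemma moment_iter s x : s \in [:: p; m; m + p; n; n + p]%N ->
  rdot (iter s T x) x = nrm2 (iter s A x).
Proof.
move=> /As_A /(congr1 (fun f => f x)) /= e.
by rewrite iter_adjoint rdotC e.
Qed.

Lemma gram_iter_commute x : T (iter p A x) = iter p A (T x).
Proof.
have [m' [k [mE nE]]] : exists m' k, m = m'.+1 /\ n = (m'.+1 + k.+1)%N.
  exists m.-1, (n - m).-1; rewrite !prednK ?subn_gt0 //.
  by rewrite subnKC // ltnW.
have K0 l : 0 <= (M ^+ 2) ^+ (l + p) + 1 by rewrite addr_ge0 ?exprn_ge0 // ltW.
have [C C0 gapC] := amgm_gap_le m'.+1 k.+1 K0 M0.
apply: (commute_of_divisible gram_sym gram_psd gram_bounded M0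
  (K := M ^+ p) (C := C) (j := (m' + k)%N)) => //.
- by rewrite exprn_ge0 // ltW.
- by move=> y; apply: iter_bounded AM _; exact: ltW.
- move=> y /gram_eq0 Ay; rewrite /= -[p]prednK // iterSr Ay.
  exact: (linear0 (iter p.-1 A)).
move=> t y /[dup] t0M /andP[t0 tM].
pose q l := rdot (iter l T (iter p A y)) (iter p A y).
pose q' l := rdot (iter (l + p) T y) y.
(* Both sides are |A^(l+p) y|^2: exponent [p] serves for l = 0, and [l] with [l + p] for [m] and
   [n]. *)
have qq' l : l \in [:: 0; m; n]%N -> q l = q' l.
  pose r := [:: p; m; m + p; n; n + p]%N.
  have [mp mm mmp mn' mnp] :
      [/\ p \in r, m \in r, (m + p)%N \in r, n \in r & (n + p)%N \in r].
    by split; rewrite !inE eqxx ?orbT.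
  rewrite !inE /q /q' => /or3P[]/eqP ->; first by rewrite add0n [RHS]moment_iter.
    by rewrite !moment_iter // -iterD.
  by rewrite !moment_iter // -iterD.
have gapE : amgm_gap t q m'.+1 k.+1 = amgm_gap t q' m'.+1 k.+1.
  by rewrite /amgm_gap -nE -mE !qq' // !inE eqxx ?orbT.
(* The lower bound is t^(n-2) |(T - t) A^p y|^2. Above, the second differences of [q'] are <T^(l+p)
   z, z> with z = (T - t) y, at most a constant times |z|^2. *)
have := amgm_gap_ge (q := q) m' k t0.
rewrite (second_diff_moment gram_sym) gapE => /(_ _)/le_trans; apply.
  move=> l; rewrite (second_diff_moment gram_sym).
  exact: (iter_psd gram_sym gram_psd).
apply: gapC => // [|l]; first exact: rdot_ge0.
have := second_diff_moment gram_sym t y (l + p).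
rewrite /second_diff /q' !addSn => ->.
exact: (moment_le gram_bounded M0).
Qed.

Lemma iter_mulp_commute j x : T (iter (j * p) A x) = iter (j * p) A (T x).
Proof.
elim: j x => // j IH x.
by rewrite mulSn iterD gram_iter_commute IH -iterD.
Qed.

(** As T commutes with A^p, the identity for the exponent [p] propagates to all its multiples. *)
Lemma adjoint_iter_mulp j x : iter (j * p) As (iter (j * p) A x) = iter (j * p) T x.
Proof.
have TAp k z : iter k T (iter p A z) = iter p A (iter k T z).
  by elim: k => // k IH; rewrite iterS IH gram_iter_commute.
elim: j x => // j IH x; rewrite mulSnr [iter _ A x]iterD addnC iterD.
rewrite [iter (j * p) As _]IH TAp [RHS]iterD.
exact: (congr1 (fun f => f _) (As_A (mem_head _ _))).
Qed.

(** The weak form of A* T^(jp) A = T^(jp+1): the extra A moves outside A^(jp), turns into T, and T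
    passes through A^(jp). *)
Lemma rdot_iter_mulp j x y :
  rdot (iter (j * p) T (A x)) (A y) = rdot (T x) (iter (j * p) T y).
Proof.
rewrite -[in LHS]adjoint_iter_mulp -[in RHS]adjoint_iter_mulp -iter_adjoint.
rewrite -iter_mulp_commute rdotC -iter_adjoint rdotC -!iterSr !iterS.
by rewrite rdotC rdot_adjoint rdotC.
Qed.

(** All inner products in the expansion of |T^p A x - A T^p x|^2 equal <T x, T^(2p) x>; the square
    of T^p A x uses j = 2, the cross term j = 1. *)
Lemma iter_gram_commute x : iter p T (A x) = A (iter p T x).
Proof.
set z := iter p T x.
have e1 : rdot (iter p T (A x)) (A z) = rdot (T x) (iter p T z).
  by have := rdot_iter_mulp 1 x z; rewrite mul1n.
have e2 : nrm2 (iter p T (A x)) = rdot (T x) (iter p T z).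
  have := rdot_iter_mulp 2 x x; rewrite mul2n -addnn !iterD => <-.
  by rewrite [RHS](iter_sym gram_sym).
have e3 : nrm2 (A z) = rdot (T x) (iter p T z).
  by rewrite rdot_adjoint -(iter_sym gram_sym) -iterSr iterS rdotC.
apply/eqP; rewrite -subr_eq0 -rdot_eq0 rdotBl !rdotBr e2 e3 e1.
by rewrite (rdotC (A z)) e1; apply/eqP; ring.
Qed.

Lemma gram_commute x : T (A x) = A (T x).
Proof.
have [C C0 TC] := iter_sub_scale_bounded gram_bounded M0 p.
apply: (commute_of_divisible gram_sym gram_psd gram_bounded M0
  (K := M) (C := M * C) (j := (2 * p.-1)%N)) => //.
- exact: ltW.
- by rewrite mulr_ge0 // ltW.
- exact: gram_eq0.
(* With W = T^p - t^p: t^(2(p-1)) |(T - t) A y|^2 <= |W A y|^2 = |A W y|^2 <= M C |(T - t) y|^2. *)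
move=> t y /[dup] t0M /andP[t0 tM].
apply: (le_trans (sub_scale_power_bound gram_sym gram_psd p.-1 (A y) t0)).
rewrite prednK // iter_gram_commute -(linearZ_LR A) -(linearB A).
by rewrite (le_trans (AM _)) // -mulrA ler_wpM2l ?TC // ltW.
Qed.

End GramOperator.

End HilbertSpace.

Theorem theorem3p8 (R : realType) (H : hilbertType R) (A : {linear H -> H})
    (m n p : nat) (hA : bounded_operator A)
    (hm : 0 < m) (hn : 0 < n) (hp : 0 < p) (hmn : m < n) :
  (forall s : nat, s \in [:: p; m; m + p; n; n + p] ->
     iter s (adjoint A) \o iter s A = iter s (adjoint A \o A))
  <-> quasinormal A.
Proof.
split=> [As_A | qA s _]; last exact: quasinormal_iter.
have [M M0 [AM AsM]] := operator_bound hA.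
apply: funext => x; symmetry.
exact: (gram_commute hA hm hp hmn As_A M0 AM AsM).
Qed.
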